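(* Let $n\ge1$ and let $\alpha_i,\psi_i,\varphi_i$ ($i=1,\dots,n$) and $\nu$ be real numbers. The Lagrangian dual (in the sense specified in the context) of the problem $$\sup_{\sigma\in\mathbb{R}}\Big\{-\tfrac12\sigma^2-\nu\sigma-\sum_{i=1}^n(\psi_i-\alpha_i\varphi_i)\varphi_i-\tfrac12\sum_{i=1}^n\frac{(\psi_i-\alpha_i\varphi_i)^2}{\alpha_i+\sigma}-\tfrac12\sum_{i=1}^n\varphi_i^2(\alpha_i+\sigma)\Big\}\quad\text{s.t. }\alpha_i+\sigma>0,\ i=1,\dots,n,$$ is the following linearly constrained convex minimization problem: $$\inf_{\lambda\in\mathbb{R}^n}\ P^{dd}(\lambda)=\sum_{i=1}^n\alpha_i\lambda_i-\sum_{i=1}^n|\psi_i-\alpha_i\varphi_i|\sqrt{2\lambda_i+\varphi_i^2}+\tfrac12\Big(\sum_{i=1}^n\lambda_i-\nu\Big)^2-\sum_{i=1}^n(\psi_i-\alpha_i\varphi_i)\varphi_i$$ $$\text{s.t. }\lambda_i+\frac{\varphi_i^2}{2}\ge 0,\quad i=1,\dots,n.$$ That is, the Lagrangian dual function $\theta(\lambda)$ defined in the context equals $P^{dd}(\lambda)$ if $\lambda_i+\varphi_i^2/2\ge0$ for all $i$, and equals $+\infty$ otherwise; and $P^{dd}$ is convex on the polyhedron $\{\lambda\in\mathbb{R}^n:\lambda_i+\varphi_i^2/2\ge0,\ i=1,\dots,n\}$.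
   Context: The Lagrangian dual is taken as follows. Write the maximization problem with auxiliary variables $r_1,\dots,r_n$ as $$\sup_{\sigma\in\mathbb{R},\,r\in\mathbb{R}^n}\ f(\sigma,r)\quad\text{s.t. }\alpha_i+\sigma=r_i,\ r_i>0,\ i=1,\dots,n,$$ where $$f(\sigma,r)=-\tfrac12\sigma^2-\nu\sigma-\sum_{i=1}^n(\psi_i-\alpha_i\varphi_i)\varphi_i-\tfrac12\sum_{i=1}^n\frac{(\psi_i-\alpha_i\varphi_i)^2}{r_i}-\tfrac12\sum_{i=1}^n\varphi_i^2 r_i .$$ Associate a multiplier $\lambda_i\in\mathbb{R}$ with the equality constraint $\alpha_i+\sigma=r_i$ and keep the constraints $r_i>0$ explicit. The Lagrangian dual function is $$\theta(\lambda)=\sup_{\sigma\in\mathbb{R},\ r_1,\dots,r_n>0}\Big\{f(\sigma,r)+\sum_{i=1}^n\lambda_i(\alpha_i+\sigma-r_i)\Big\}\in\mathbb{R}\cup\{+\infty\},$$ and the Lagrangian dual problem is $\inf_{\lambda\in\mathbb{R}^n}\theta(\lambda)$. *)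

(* Defs.v *)
From mathcomp Require Import all_boot all_order all_algebra.
From mathcomp Require Import boolp classical_sets constructive_ereal reals.
From mathcomp Require Import ereal interval_inference convex.

Set Implicit Arguments.
Unset Strict Implicit.
Unset Printing Implicit Defensive.

Import Order.TTheory GRing.Theory Num.Theory.

Local Open Scope classical_set_scope.
Local Open Scope ring_scope.

(* Values in [\bar R] because suprema and infima may be infinite, with
   sup set0 = -oo and inf set0 = +oo. *)
Definition sup_value (R : realType) (T : Type) (X : set T) (obj : T -> R) :
  \bar R := ereal_sup [set (obj x)%:E | x in X].

Definition inf_value (R : realType) (T : Type) (X : set T) (obj : T -> R) :
  \bar R := ereal_inf [set (obj x)%:E | x in X].

(* Dual function of  sup { obj x | x in X, g i x = 0 for all i }:  only the
   equality constraints are dualized, membership in X is kept explicit. *)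
Definition lagrangian_dual (R : realType) (T : Type) (n : nat) (X : set T)
    (obj : T -> R) (g : 'I_n -> T -> R) (lambda : 'rV[R]_n) : \bar R :=
  sup_value X (fun x => obj x + \sum_(i < n) lambda 0 i * g i x).

Definition primal_feasible (R : realType) (n : nat) (alpha : 'I_n -> R) :
  set R := [set sigma | forall i, 0 < alpha i + sigma].

Definition primal_obj (R : realType) (n : nat) (alpha psi phi : 'I_n -> R)
    (nu sigma : R) : R :=
  - 2^-1 * sigma ^+ 2 - nu * sigma
  - \sum_(i < n) (psi i - alpha i * phi i) * phi i
  - 2^-1 * \sum_(i < n) (psi i - alpha i * phi i) ^+ 2 / (alpha i + sigma)
  - 2^-1 * \sum_(i < n) phi i ^+ 2 * (alpha i + sigma).

(* The same problem in the variables x = (sigma, r), with r i standing for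
   alpha i + sigma. *)
Definition split_domain (R : realType) (n : nat) : set (R * 'rV[R]_n) :=
  [set x : R * 'rV[R]_n | forall i, 0 < x.2 0 i].

Definition split_constraint (R : realType) (n : nat) (alpha : 'I_n -> R)
    (i : 'I_n) (x : R * 'rV[R]_n) : R :=
  alpha i + x.1 - x.2 0 i.

Definition split_feasible (R : realType) (n : nat) (alpha : 'I_n -> R) :
    set (R * 'rV[R]_n) :=
  [set x : R * 'rV[R]_n |
   (forall i, split_constraint alpha i x = 0) /\ split_domain x].

Definition split_obj (R : realType) (n : nat) (alpha psi phi : 'I_n -> R)
    (nu : R) (x : R * 'rV[R]_n) : R :=
  - 2^-1 * x.1 ^+ 2 - nu * x.1
  - \sum_(i < n) (psi i - alpha i * phi i) * phi i
  - 2^-1 * \sum_(i < n) (psi i - alpha i * phi i) ^+ 2 / x.2 0 i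
  - 2^-1 * \sum_(i < n) phi i ^+ 2 * x.2 0 i.

Definition theta (R : realType) (n : nat) (alpha psi phi : 'I_n -> R) (nu : R) :
    'rV[R]_n -> \bar R :=
  lagrangian_dual (@split_domain R n) (split_obj alpha psi phi nu)
    (split_constraint alpha).

Definition dual_feasible (R : realType) (n : nat) (phi : 'I_n -> R) :
  set 'rV[R]_n :=
  [set lambda : 'rV[R]_n | forall i, 0 <= lambda 0 i + phi i ^+ 2 / 2].

(* [Num.sqrt] is 0 on negative reals; on [dual_feasible phi] its argument is
   nonnegative. *)
Definition Pdd (R : realType) (n : nat) (alpha psi phi : 'I_n -> R) (nu : R)
    (lambda : 'rV[R]_n) : R :=
  \sum_(i < n) alpha i * lambda 0 i
  - \sum_(i < n) `|psi i - alpha i * phi i| *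
      Num.sqrt (2 * lambda 0 i + phi i ^+ 2)
  + 2^-1 * (\sum_(i < n) lambda 0 i - nu) ^+ 2
  - \sum_(i < n) (psi i - alpha i * phi i) * phi i.

(* Main.v *)
(* The dualized objective separates into a concave quadratic in sigma, maximal
   at sigma = sum lambda - nu, and for each i the penalty
     (b^2 / r + c r) / 2,   b = psi_i - alpha_i phi_i,  c = 2 lambda_i + phi_i^2.
   For c >= 0 its infimum over r > 0 is |b| sqrt c by AM-GM, not attained in
   general but approached along r = (|b| + d) / (sqrt c + d) as d -> 0+; for
   c < 0 it is unbounded below as r -> +oo.  Since theta is a supremum of
   functions affine in lambda and agrees with Pdd on the polyhedron, Pdd is
   convex there. *)
Require Import Defs.
From mathcomp Require Import all_boot all_order all_algebra.
From mathcomp Require Import boolp classical_sets constructive_ereal reals.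
From mathcomp Require Import ereal interval_inference convex.
From mathcomp Require Import ring lra.

Set Implicit Arguments.
Unset Strict Implicit.
Unset Printing Implicit Defensive.

Import Order.TTheory GRing.Theory Num.Theory.

Local Open Scope classical_set_scope.
Local Open Scope ring_scope.

(** * Bounds on the penalty of a single coordinate *)

Section ScalarPenalty.
Variable R : realType.
Implicit Types b c r s d : R.

Definition penalty b c r : R := 2^-1 * (b ^+ 2 / r + c * r).

(** The gap is half of a square divided by [r]. Writing the coefficient as [s ^+ 2] keeps square
    roots out of the algebra. *)
Lemma penalty_ge b s r : 0 < r -> `|b| * s <= penalty b (s ^+ 2) r.
Proof.
move=> r0; rewrite -subr_ge0 /penalty -(real_normK (num_real b)).
have -> : 2^-1 * (`|b| ^+ 2 / r + s ^+ 2 * r) - `|b| * s =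
    2^-1 * ((`|b| - s * r) ^+ 2 / r) by field; rewrite gt_eqF.
by rewrite mulr_ge0 ?invr_ge0// divr_ge0 ?sqr_ge0 ?ltW.
Qed.

(** At this [r] each of the two terms contains a factor [x ^+ 2 / (x + d)], with [x] equal to [|b|]
    or [s], which is at most [x]. The shift by [d] keeps [r] well defined and positive when [b] or
    [s] vanishes. *)
Lemma penalty_le b s d : 0 <= s -> 0 < d ->
  penalty b (s ^+ 2) ((`|b| + d) / (s + d)) <=
    `|b| * s + d * (2^-1 * (`|b| + s)).
Proof.
move=> s0 d0; rewrite /penalty -(real_normK (num_real b)).
move: (`|b|) (normr_ge0 b) => a a0.
have sd0 : 0 < s + d by rewrite ltr_wpDl.
have ad0 : 0 < a + d by rewrite ltr_wpDl.
have sq_le x : 0 <= x -> 0 < x + d -> x ^+ 2 / (x + d) <= x.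
  by move=> x0 xd0; rewrite ler_pdivrMr// mulrDr -expr2 lerDl mulr_ge0// ltW.
have -> : 2^-1 * (a ^+ 2 / ((a + d) / (s + d)) +
      s ^+ 2 * ((a + d) / (s + d))) =
    2^-1 * (a ^+ 2 / (a + d) * (s + d) + s ^+ 2 / (s + d) * (a + d)).
  by field; rewrite !gt_eqF.
have -> : a * s + d * (2^-1 * (a + s)) =
    2^-1 * (a * (s + d) + s * (a + d)) by field.
by rewrite ler_wpM2l ?invr_ge0// lerD// ler_wpM2r ?sq_le// ltW.
Qed.

Lemma penalty_unbounded b c M : c < 0 -> exists2 r, 0 < r & penalty b c r <= M.
Proof.
(* This [r] makes [c * r] cancel [b ^+ 2] and leave [c - 2 * |M|], while [1 <= r] keeps [b ^+ 2 / r]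
   below [b ^+ 2]. *)
move=> c0; set r := 1 + (b ^+ 2 + 2 * `|M|) / - c.
have b2 : 0 <= b ^+ 2 := sqr_ge0 b.
have M0 : 0 <= `|M| by [].
have r1 : 1 <= r by rewrite lerDl divr_ge0 ?oppr_ge0 ?(ltW c0)//; lra.
have r0 : 0 < r := lt_le_trans ltr01 r1.
exists r => //; rewrite /penalty.
have -> : c * r = c - (b ^+ 2 + 2 * `|M|) by rewrite /r; field; rewrite lt_eqF.
have : b ^+ 2 / r <= b ^+ 2 by rewrite ler_pdivrMr// ler_peMr.
have : - `|M| <= M by rewrite lerNl -normrN ler_norm.
lra.
Qed.

End ScalarPenalty.

(** * Computation of the dual function *)

Section LagrangianDual.
Variables (R : realType) (n : nat) (alpha psi phi : 'I_n -> R) (nu : R).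
Implicit Types lambda : 'rV[R]_n.

Local Notation b i := (psi i - alpha i * phi i).
Local Notation c lambda i := (2 * lambda 0 i + phi i ^+ 2).

Definition lagrangian lambda (x : R * 'rV[R]_n) : R :=
  split_obj alpha psi phi nu x
  + \sum_(i < n) lambda 0 i * split_constraint alpha i x.

(** The multiplier term in [r i] joins the [phi i ^+ 2] term of the objective, which produces the
    coefficient [2 * lambda 0 i + phi i ^+ 2]. *)
Lemma lagrangianE lambda x :
  lagrangian lambda x =
  - 2^-1 * x.1 ^+ 2 + (\sum_(i < n) lambda 0 i - nu) * x.1
  + \sum_(i < n) alpha i * lambda 0 i
  - \sum_(i < n) b i * phi i
  - \sum_(i < n) penalty (b i) (c lambda i) (x.2 0 i).
Proof.
have -> : \sum_(i < n) penalty (b i) (c lambda i) (x.2 0 i) =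
    2^-1 * \sum_(i < n) b i ^+ 2 / x.2 0 i
    + 2^-1 * \sum_(i < n) phi i ^+ 2 * x.2 0 i
    + \sum_(i < n) lambda 0 i * x.2 0 i.
  rewrite !mulr_sumr -!big_split; apply: eq_bigr => i _ /=.
  by rewrite /penalty; lra.
have -> : (\sum_(i < n) lambda 0 i - nu) * x.1 =
    \sum_(i < n) lambda 0 i * x.1 - nu * x.1 by rewrite mulrBl mulr_suml.
have constraintE : \sum_(i < n) lambda 0 i * split_constraint alpha i x =
    \sum_(i < n) alpha i * lambda 0 i + \sum_(i < n) lambda 0 i * x.1
    - \sum_(i < n) lambda 0 i * x.2 0 i.
  rewrite -sumrN -!big_split; apply: eq_bigr => i _ /=.
  by rewrite /split_constraint; ring.
by rewrite /lagrangian /split_obj constraintE; ring.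
Qed.

Lemma lagrangian_conv (t : R) lambda mu x :
  lagrangian (t *: lambda + (1 - t) *: mu) x =
  t * lagrangian lambda x + (1 - t) * lagrangian mu x.
Proof.
rewrite /lagrangian.
have -> : \sum_(i < n) (t *: lambda + (1 - t) *: mu) 0 i *
      split_constraint alpha i x =
    t * (\sum_(i < n) lambda 0 i * split_constraint alpha i x) +
    (1 - t) * (\sum_(i < n) mu 0 i * split_constraint alpha i x).
  by rewrite !mulr_sumr -big_split; apply: eq_bigr => i _ /=; rewrite !mxE; ring.
by ring.
Qed.

Lemma dual_feasible_ge0 lambda i : dual_feasible phi lambda -> 0 <= c lambda i.
Proof. by move=> /(_ i); lra. Qed.

Lemma lagrangian_le_Pdd lambda x : dual_feasible phi lambda ->
  split_domain x -> lagrangian lambda x <= Pdd alpha psi phi nu lambda.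
Proof.
move=> feas x0; rewrite lagrangianE /Pdd.
have : \sum_(i < n) `|b i| * Num.sqrt (c lambda i) <=
    \sum_(i < n) penalty (b i) (c lambda i) (x.2 0 i).
  apply: ler_sum => i _; rewrite -[c lambda i in leRHS]sqr_sqrtr.
    exact: penalty_ge.
  exact: dual_feasible_ge0.
move: (\sum_(i < n) lambda 0 i - nu) => q.
(* Completing the square bounds the part in sigma by [2^-1 * q ^+ 2]. *)
have : 0 <= (q - x.1) ^+ 2 := sqr_ge0 _.
rewrite sqrrB mulrC; lra.
Qed.

Lemma theta_feasible lambda : dual_feasible phi lambda ->
  theta alpha psi phi nu lambda = (Pdd alpha psi phi nu lambda)%:E.
Proof.
move=> feas; apply/eqP; rewrite eq_le; apply/andP; split.
  apply: ge_ereal_sup => _ [x x0 <-]; rewrite lee_fin.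
  exact: lagrangian_le_Pdd.
apply/lee_addgt0Pr => e e0.
pose s i := Num.sqrt (c lambda i).
pose K := \sum_(i < n) 2^-1 * (`|b i| + s i).
have K0 : 0 <= K.
  by apply: sumr_ge0 => i _; rewrite mulr_ge0 ?invr_ge0 ?addr_ge0 ?sqrtr_ge0.
(* The penalties together exceed their infima by at most [d * K], so [d] is chosen to make this at
   most [e]; adding 1 avoids division by zero when [K = 0]. *)
pose d := e / (K + 1).
have K1 : 0 < K + 1 by rewrite ltr_wpDl.
have d0 : 0 < d by rewrite divr_gt0.
have dK : d * K <= e.
  by rewrite mulrAC ler_pdivrMr// ler_pM2l// lerDl.
(* Sigma is the exact maximizer, so only the penalties lose anything. *)
pose x : R * 'rV[R]_n := (\sum_(i < n) lambda 0 i - nu,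
                          \row_i ((`|b i| + d) / (s i + d))).
have x0 : split_domain x.
  by move=> i; rewrite mxE divr_gt0// ltr_wpDl// sqrtr_ge0.
rewrite -leeBlDr//.
apply: le_ereal_sup_tmp; exists (lagrangian lambda x)%:E; first by exists x.
rewrite lee_fin lerBlDr lagrangianE /Pdd.
have : \sum_(i < n) penalty (b i) (c lambda i) (x.2 0 i) <=
    \sum_(i < n) `|b i| * s i + d * K.
  rewrite mulr_sumr -big_split; apply: ler_sum => i _ /=.
  rewrite mxE -[c lambda i in leLHS]sqr_sqrtr; last exact: dual_feasible_ge0.
  by apply: penalty_le => //; exact: sqrtr_ge0.
rewrite /= -/(s _); move: (\sum_(i < n) lambda 0 i - nu) => q.
rewrite expr2; lra.
Qed.

Lemma theta_infeasible lambda : ~ dual_feasible phi lambda ->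
  theta alpha psi phi nu lambda = +oo%E.
Proof.
move=> /existsNP[j /negP]; rewrite -ltNge => cj0.
have {}cj0 : c lambda j < 0 by lra.
apply/eqyP => A _.
(* With sigma = 0 and every other [r i] equal to 1, the Lagrangian is at least [A] as soon as the
   penalty at [j] is at most [M]. *)
set M := \sum_(i < n) alpha i * lambda 0 i - \sum_(i < n) b i * phi i
  - \sum_(i < n | i != j) penalty (b i) (c lambda i) 1 - A.
have [r r0 rM] := penalty_unbounded (b j) M cj0.
pose x : R * 'rV[R]_n := (0, \row_i if i == j then r else 1).
apply: le_ereal_sup_tmp; exists (lagrangian lambda x)%:E.
  by exists x => // i; rewrite mxE; case: ifP.
have -> : lagrangian lambda x = \sum_(i < n) alpha i * lambda 0 i
    - \sum_(i < n) b i * phi i - (penalty (b j) (c lambda j) r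
      + \sum_(i < n | i != j) penalty (b i) (c lambda i) 1).
  rewrite lagrangianE /= expr0n !mulr0 !add0r; congr (_ - _).
  rewrite (bigD1 j)//= mxE eqxx; congr (_ + _).
  by apply: eq_bigr => i ij; rewrite mxE (negbTE ij).
by rewrite lee_fin; move: rM; rewrite /M; lra.
Qed.

Lemma ereal_inf_theta :
  ereal_inf [set theta alpha psi phi nu lambda | lambda in setT] =
  inf_value (dual_feasible phi) (Pdd alpha psi phi nu).
Proof.
apply/eqP; rewrite eq_le; apply/andP; split; apply: le_ereal_inf_tmp.
  move=> _ [lambda feas <-]; apply: ereal_inf_lbound.
  by exists lambda => //; exact: theta_feasible.
move=> _ [lambda _ <-].
have [feas|infeas] := pselect (dual_feasible phi lambda).
  by rewrite theta_feasible//; apply: ereal_inf_lbound; exists lambda.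
by rewrite theta_infeasible// leey.
Qed.

(** * Convexity of the dual problem, and the two forms of the primal *)

Lemma convex_set_dual_feasible : convex_set (dual_feasible phi).
Proof.
move=> lambda mu t; rewrite !inE => feas_lambda feas_mu i.
have t1 : 0 <= 1 - t%:num by rewrite subr_ge0.
have -> : conv t lambda mu 0 i + phi i ^+ 2 / 2 =
    t%:num * (lambda 0 i + phi i ^+ 2 / 2) +
    (1 - t%:num) * (mu 0 i + phi i ^+ 2 / 2) by rewrite !mxE /unstable.onem; ring.
by rewrite addr_ge0// mulr_ge0.
Qed.

Lemma convex_function_Pdd :
  convex_function (dual_feasible phi) (Pdd alpha psi phi nu).
Proof.
move=> t lambda mu lambdaP muP.
have := convex_set_dual_feasible t lambdaP muP.
move: lambdaP muP; rewrite !inE => feas_lambda feas_mu feas.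
(* Only the value at the convex combination is turned back into a supremum. Each Lagrangian value
   there splits affinely, and weak duality bounds the two pieces at the endpoints. *)
rewrite -lee_fin -theta_feasible//; apply: ge_ereal_sup => _ [x x0 <-].
rewrite lee_fin -/(lagrangian _ _) lagrangian_conv.
by rewrite lerD// ler_wpM2l ?subr_ge0//; exact: lagrangian_le_Pdd.
Qed.

(** The equality constraints determine [r] from sigma, so both suprema range over the same set of
    values. *)
Lemma sup_value_split :
  sup_value (primal_feasible alpha) (primal_obj alpha psi phi nu) =
  sup_value (split_feasible alpha) (split_obj alpha psi phi nu).
Proof.
congr ereal_sup; apply/seteqP; split.
  move=> _ [sigma feas <-]; exists (sigma, \row_i (alpha i + sigma)).
    by split=> i; rewrite /split_constraint mxE ?subrr.
  by congr (_ - _ * _ - _ * _)%:E; apply: eq_bigr => i _; rewrite mxE.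
move=> _ [[sigma r] [constr r0] <-].
have rE i : r 0 i = alpha i + sigma.
  by apply/esym/eqP; rewrite -subr_eq0; apply/eqP; exact: constr.
exists sigma; first by move=> i; rewrite -rE; exact: r0.
by congr (_ - _ * _ - _ * _)%:E; apply: eq_bigr => i _; rewrite rE.
Qed.

End LagrangianDual.

Theorem proposition1 (R : realType) (n : nat) (hn : (1 <= n)%N)
    (alpha psi phi : 'I_n -> R) (nu : R) :
  [/\ sup_value (primal_feasible alpha) (primal_obj alpha psi phi nu) =
        sup_value (split_feasible alpha) (split_obj alpha psi phi nu),
      forall lambda : 'rV[R]_n,
        (dual_feasible phi lambda ->
           theta alpha psi phi nu lambda = (Pdd alpha psi phi nu lambda)%:E) /\
        (~ dual_feasible phi lambda -> theta alpha psi phi nu lambda = +oo%E),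
      ereal_inf [set theta alpha psi phi nu lambda | lambda in setT] =
        inf_value (dual_feasible phi) (Pdd alpha psi phi nu),
      convex_set (dual_feasible phi) &
      convex_function (dual_feasible phi) (Pdd alpha psi phi nu)].
Proof.
split.
- exact: sup_value_split.
- by move=> lambda; split; [exact: theta_feasible | exact: theta_infeasible].
- exact: ereal_inf_theta.
- exact: convex_set_dual_feasible.
- exact: convex_function_Pdd.
Qed.
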